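(* For every positive integer $n$, during a complete run of $\mathrm{AccelAsc}(n)$, the write statements executed after initialisation are ''$a_k\leftarrow x$'' (in both inner loops), ''$a_\ell\leftarrow y$'' and ''$a_k\leftarrow y+1$''. Together they are executed a total of exactly $2p(n)-1$ times.
   Context: $p(n)$ denotes the number of partitions of $n$, with the conventions $p(0)=1$ and $p(j)=0$ for $j<0$. The procedure $\mathrm{AccelAsc}(n)$, for $n\ge1$, operates on an array $a$ as follows and visits every ascending composition of $n$ (a sequence of positive integers in nondecreasing order summing to $n$) exactly once: 1. Initialisation: $k\leftarrow 2$; $a_1\leftarrow 0$; $y\leftarrow n-1$. 2. While $k\ne 1$: - $k\leftarrow k-1$; $x\leftarrow a_k+1$. - While $2x\le y$: $a_k\leftarrow x$; $y\leftarrow y-x$; $k\leftarrow k+1$. - $\ell\leftarrow k+1$. - While $x\le y$: $a_k\leftarrow x$; $a_\ell\leftarrow y$; visit $\langle a_1,\dots,a_\ell\rangle$; $x\leftarrow x+1$; $y\leftarrow y-1$. - $y\leftarrow y+x-1$; $a_k\leftarrow y+1$; visit $\langle a_1,\dots,a_k\rangle$. *)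

(* Defs.v *)
From mathcomp Require Import all_boot all_order all_algebra.

Set Implicit Arguments.
Unset Strict Implicit.
Unset Printing Implicit Defensive.

Import Order.TTheory GRing.Theory Num.Theory.

Definition is_partition (n : nat) (s : seq nat) : bool :=
  [&& sorted geq s, all (leq 1) s & sumn s == n].

(** A partition of [n] has at most [n] parts, each at most [n], so the bounds in
    [n.-bseq 'I_n.+1] exclude nothing. *)
Definition num_partitions (n : nat) : nat :=
  #|[set s : n.-bseq 'I_n.+1 | is_partition n [seq val i | i <- s]]|.

Local Open Scope ring_scope.

(** The variables of the procedure.  [x], [y] and the array contents are
    integers, so that no subtraction on them is truncated; [k] and [l] are array
    positions. *)
Record state : Type := State {
  st_k : nat;
  st_l : nat;
  st_x : int;
  st_y : int;
  st_a : nat -> int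
}.

(** The occurrences of array assignments in the program text. *)
Inductive write_stmt : Type :=
  | Write_init      (* [a_1 <- 0], initialisation *)
  | Write_k_first   (* [a_k <- x], first inner loop *)
  | Write_k_second  (* [a_k <- x], second inner loop *)
  | Write_l         (* [a_l <- y] *)
  | Write_final.    (* [a_k <- y + 1] *)

Inductive event : Type :=
  | Wrote of write_stmt
  | Visited of seq int.

(** A while language with expressions given as functions of the state. *)
Inductive cmd : Type :=
  | SetK of (state -> nat)
  | SetL of (state -> nat)
  | SetX of (state -> int)
  | SetY of (state -> int)
  | Write of write_stmt & (state -> nat) & (state -> int)
  | Visit of (state -> nat)  (* [Visit m] visits [<a_1, ..., a_m>] *)
  | Seq of cmd & cmd
  | While of (state -> bool) & cmd.

Declare Scope cmd_scope.
Delimit Scope cmd_scope with cmd.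
Bind Scope cmd_scope with cmd.
Notation "c1 ;; c2" := (Seq c1 c2)
  (at level 100, c2 at level 200, right associativity,
   format "'[v' c1  ;; '/' c2 ']'") : cmd_scope.

Definition upd (a : nat -> int) (i : nat) (v : int) : nat -> int :=
  fun j => if j == i then v else a j.

(** [exec c s tr s']: started in [s], [c] terminates in [s'], and [tr] lists in
    order the array writes and visits performed on the way. *)
Inductive exec : cmd -> state -> seq event -> state -> Prop :=
  | exec_SetK e s :
      exec (SetK e) s [::] (State (e s) (st_l s) (st_x s) (st_y s) (st_a s))
  | exec_SetL e s :
      exec (SetL e) s [::] (State (st_k s) (e s) (st_x s) (st_y s) (st_a s))
  | exec_SetX e s :
      exec (SetX e) s [::] (State (st_k s) (st_l s) (e s) (st_y s) (st_a s))
  | exec_SetY e s :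
      exec (SetY e) s [::] (State (st_k s) (st_l s) (st_x s) (e s) (st_a s))
  | exec_Write w i e s :
      exec (Write w i e) s [:: Wrote w]
        (State (st_k s) (st_l s) (st_x s) (st_y s) (upd (st_a s) (i s) (e s)))
  | exec_Visit m s :
      exec (Visit m) s [:: Visited [seq st_a s i | i <- iota 1 (m s)]] s
  | exec_Seq c1 c2 s1 s2 s3 tr1 tr2 :
      exec c1 s1 tr1 s2 -> exec c2 s2 tr2 s3 ->
      exec (Seq c1 c2) s1 (tr1 ++ tr2) s3
  | exec_While_false (b : state -> bool) c s :
      ~~ b s -> exec (While b c) s [::] s
  | exec_While_true (b : state -> bool) c s1 s2 s3 tr1 tr2 :
      b s1 -> exec c s1 tr1 s2 -> exec (While b c) s2 tr2 s3 ->
      exec (While b c) s1 (tr1 ++ tr2) s3.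

Definition AccelAsc (n : nat) : cmd := (
  SetK (fun _ => 2%N) ;;
  Write Write_init (fun _ => 1%N) (fun _ => 0) ;;
  SetY (fun _ => n%:Z - 1) ;;
  While (fun s => st_k s != 1%N) (
    SetK (fun s => (st_k s - 1)%N) ;;
    SetX (fun s => st_a s (st_k s) + 1) ;;
    While (fun s => 2 * st_x s <= st_y s) (
      Write Write_k_first (fun s => st_k s) (fun s => st_x s) ;;
      SetY (fun s => st_y s - st_x s) ;;
      SetK (fun s => (st_k s + 1)%N)
    ) ;;
    SetL (fun s => (st_k s + 1)%N) ;;
    While (fun s => st_x s <= st_y s) (
      Write Write_k_second (fun s => st_k s) (fun s => st_x s) ;;
      Write Write_l (fun s => st_l s) (fun s => st_y s) ;;
      Visit (fun s => st_l s) ;;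
      SetX (fun s => st_x s + 1) ;;
      SetY (fun s => st_y s - 1)
    ) ;;
    SetY (fun s => st_y s + st_x s - 1) ;;
    Write Write_final (fun s => st_k s) (fun s => st_y s + 1) ;;
    Visit (fun s => st_k s)
  )
)%cmd.

Definition is_write_after_init (e : event) : bool :=
  match e with
  | Wrote Write_init => false
  | Wrote _ => true
  | Visited _ => false
  end.

(* Main.v *)
Require Import Defs.
From mathcomp Require Import all_boot all_order all_algebra.
From mathcomp Require Import zify.

(** The second inner loop makes two writes per visit and the final statement one
    write per visit.  [k] is decremented once per final statement, incremented
    once per write of the first inner loop, and drops from 2 to 1 overall, so the
    first inner loop writes once less than the final statement.  Hence there
    are two writes per visit, minus one.  The visits are counted along the
    recursion that splits the ascending compositions of [x + y] with parts at
    least [x] according to whether their first part is [x]: the procedure started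
    with [a_k + 1 = x] treats those starting with [x] at position [k + 1], with
    [y - x] for [y], and returns to [k] with [x + 1] and [y - 1]. *)

Set Implicit Arguments.
Unset Strict Implicit.
Unset Printing Implicit Defensive.

(** By determinism, one explicitly built run settles the claim about all runs. *)
Lemma exec_deterministic c s tr1 s1 tr2 s2 :
  exec c s tr1 s1 -> exec c s tr2 s2 -> tr1 = tr2 /\ s1 = s2.
Proof.
move=> E1; elim: E1 tr2 s2 => {c s tr1 s1}.
1-6: by move=> > E; inversion E; subst.
- move=> c1 c2 s1 s2 s3 tr1 tr2 _ IH1 _ IH2 tr s' E.
  inversion E as [| | | | | |? ? ? s2' ? ? ? E1 E2| |]; subst.
  by have [? ?] := IH1 _ _ E1; subst; have [? ?] := IH2 _ _ E2; subst.
- move=> b c s /negP nb tr s' E.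
  by inversion E.
- move=> b c s1 s2 s3 tr1 tr2 bs _ IH1 _ IH2 tr s' E.
  inversion E as [| | | | | | |? ? ? nb|? ? ? s2' ? ? ? ? E1 E2]; subst.
    by rewrite bs in nb.
  by have [? ?] := IH1 _ _ E1; subst; have [? ?] := IH2 _ _ E2; subst.
Qed.

(** The ascending compositions of [x + y] with parts at least [x], provided
    [0 < x] and the fuel exceeds [y]. *)
Fixpoint ascending (fuel x y : nat) : seq (seq nat) :=
  if fuel is f.+1 then
    if x <= y then
      [seq x :: t | t <- ascending f x (y - x)] ++ ascending f x.+1 y.-1
    else [:: [:: x + y]]
  else [::].

(** A member either begins with [x] or has all parts at least [x.+1], and then [x.+1 + y.-1] is the
    same sum. If [y < x], two parts would already exceed the sum. *)
Lemma mem_ascending f x y s : 0 < x -> y < f ->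
  (s \in ascending f x y) = path leq x s && (sumn s == x + y).
Proof.
elim: f x y s => // f IH x y s x0 yf /=.
case: leqP => xy; last first.
  rewrite inE; case: s => [|h [|h' t]] /=.
  - by rewrite -[LHS]/false; lia.
  - by rewrite eqseq_cons eqxx; lia.
  - by rewrite eqseq_cons andbF; case: path; lia.
rewrite mem_cat IH //; last by lia.
have -> : x.+1 + y.-1 = x + y by lia.
case: s => [|h t] /=; first by case: mapP => [[]|].
case: (ltngtP x h) => [xh|hx|<-] /=.
- by case: mapP => [[t' _ [e _]]|_] //; lia.
- by case: mapP => [[t' _ [e _]]|_] //; lia.
- rewrite mem_map => [|? ? [] //].
  by rewrite orbF IH ?subnKC ?eqn_add2l //; lia.
Qed.

Lemma ascending_uniq f x y : 0 < x -> y < f -> uniq (ascending f x y).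
Proof.
elim: f x y => // f IH x y x0 yf /=.
case: leqP => // xy; rewrite cat_uniq map_inj_uniq => [|? ? [] //].
rewrite !IH ?andbT //=; try lia.
apply/hasPn => s; rewrite mem_ascending //; last by lia.
by case/andP => sx _; apply/mapP => -[t _ e]; move: sx; rewrite e /= ltnn.
Qed.

(** Keeps the truncated subtractions in the write counts exact. *)
Lemma size_ascending_gt0 f x y : 0 < x -> y < f -> 0 < size (ascending f x y).
Proof.
elim: f x y => // f IH x y x0 yf /=; case: (leqP x y) => // xy.
rewrite size_cat; have := IH x.+1 y.-1; lia.
Qed.

Lemma size_le_sumn s : all (leq 1) s -> size s <= sumn s.
Proof. by elim: s => //= h t IH /andP[h0 /IH]; lia. Qed.

(** Reversal turns partitions into ascending compositions; both lists are duplicate-free with the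
    same members. *)
Lemma num_partitionsE n : 0 < n ->
  num_partitions n = size (ascending n 1 n.-1).
Proof.
move=> n0; rewrite /num_partitions cardE.
set A := enum _.
pose g (s : n.-bseq 'I_n.+1) := rev [seq val i | i <- s].
rewrite -(size_map g); apply/perm_size/uniq_perm.
- rewrite map_inj_uniq ?enum_uniq // => s t /(congr1 rev); rewrite !revK.
  by move/(inj_map val_inj)/val_inj.
- by apply: ascending_uniq; lia.
have sortedE s : path leq 1 s = sorted geq (rev s) && all (leq 1) (rev s).
  by rewrite path_sortedE ?rev_sorted ?all_rev 1?andbC //; apply: leq_trans.
move=> s; rewrite mem_ascending //; last by lia.
rewrite add1n prednK // sortedE -sumn_rev -andbA; apply/mapP/idP => [[t]|ps].
  by rewrite mem_enum inE => ? ->; rewrite /g revK.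
have /and3P[_ pos /eqP sum] := ps.
(* Positive parts with sum [n] are at most [n] in number and in size, so [inord] loses nothing. *)
have sz : size (map (@inord n) (rev s)) <= n.
  by rewrite size_map -[X in _ <= X]sum size_le_sumn.
have vK : [seq val i | i <- map (@inord n) (rev s)] = rev s.
  rewrite -map_comp; apply: map_id_in => i i_s /=; rewrite inordK // ltnS -sum.
  by rewrite (perm_sumn (perm_to_rem i_s)) /= leq_addr.
exists (Bseq sz); last by rewrite /g vK revK.
by rewrite mem_enum inE vK.
Qed.

Local Open Scope ring_scope.

Definition first_loop : cmd :=
  While (fun s => 2 * st_x s <= st_y s) (
    Write Write_k_first (fun s => st_k s) (fun s => st_x s) ;;
    SetY (fun s => st_y s - st_x s) ;;
    SetK (fun s => (st_k s + 1)%N))%cmd.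

Definition second_loop : cmd :=
  While (fun s => st_x s <= st_y s) (
    Write Write_k_second (fun s => st_k s) (fun s => st_x s) ;;
    Write Write_l (fun s => st_l s) (fun s => st_y s) ;;
    Visit (fun s => st_l s) ;;
    SetX (fun s => st_x s + 1) ;;
    SetY (fun s => st_y s - 1))%cmd.

Definition after_first_loop : cmd := (
  SetL (fun s => (st_k s + 1)%N) ;;
  second_loop ;;
  SetY (fun s => st_y s + st_x s - 1) ;;
  Write Write_final (fun s => st_k s) (fun s => st_y s + 1) ;;
  Visit (fun s => st_k s))%cmd.

Definition main_loop : cmd :=
  While (fun s => st_k s != 1%N) (
    SetK (fun s => (st_k s - 1)%N) ;;
    SetX (fun s => st_a s (st_k s) + 1) ;;
    first_loop ;;
    after_first_loop)%cmd.

Lemma AccelAscE n :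
  AccelAsc n = (SetK (fun _ => 2%N) ;;
                Write Write_init (fun _ => 1%N) (fun _ => 0) ;;
                SetY (fun _ => n%:Z - 1) ;;
                main_loop)%cmd.
Proof. by []. Qed.

Local Close Scope ring_scope.

Ltac exec_assignment := first
  [ apply: exec_SetK | apply: exec_SetL | apply: exec_SetX | apply: exec_SetY
  | apply: exec_Write | apply: exec_Visit ].

(** As [y < 2 * x], the compositions have at most two parts. Each pass visits one with two parts;
    the one-part composition is left to the final statement, whence the [.-1]. *)
Lemma exec_second_loop f (x y : nat) s :
    0 < x -> y < 2 * x -> y < f ->
    st_x s = x -> st_y s = y -> st_l s = st_k s + 1 ->
  exists tr s',
    [/\ exec second_loop s tr s',
        st_k s' = st_k s,
        (st_y s' + st_x s' = (x + y)%:Z)%R,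
        forall j, j < st_k s -> st_a s' j = st_a s j &
        count is_write_after_init tr = 2 * (size (ascending f x y)).-1].
Proof.
elim: f x y s => // f IH x y s x0 y2x yf sx sy sl /=.
case: leqP => xy; last first.
  exists [::], s; split=> //; last by rewrite sx sy; lia.
  by apply: exec_While_false; rewrite sx sy; lia.
set s1 := State (st_k s) (st_l s) (st_x s + 1)%R (st_y s - 1)%R
  (upd (upd (st_a s) (st_k s) (st_x s)) (st_l s) (st_y s)).
have [||||||tr [s' [E ks' ys' as' cs']]] := IH x.+1 y.-1 s1; rewrite /= ?sx ?sy;
  try lia; try done.
exists ([:: Wrote Write_k_second] ++ [:: Wrote Write_l] ++
  [:: Visited [seq upd (upd (st_a s) (st_k s) (st_x s)) (st_l s) (st_y s) i
              | i <- iota 1 (st_l s)]] ++ [::] ++ [::] ++ tr), s'.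
split=> //.
- rewrite !catA; apply: (@exec_While_true _ _ s s1) E.
    by rewrite sx sy; lia.
  rewrite -!catA.
  by do !(apply: exec_Seq; first by exec_assignment); exec_assignment.
- by rewrite ys'; lia.
- move=> j jk; rewrite as' //= /upd.
  by do 2 (case: eqP; first by lia).
- rewrite !count_cat /= cs' size_cat size_map.
  have := @size_ascending_gt0 f x.+1 y.-1.
  (* Since [y - x < x], only the tail [[:: y]] can follow [x]. *)
  have -> : size (ascending f x (y - x)) = 1.
    by case: f yf {IH E cs'} => [|f] yf /=; [lia | case: leqP => //; lia].
  by lia.
Qed.

Lemma exec_after_first_loop f (x y : nat) s :
    0 < x -> y < 2 * x -> y < f -> st_x s = x -> st_y s = y ->
  exists tr s',
    [/\ exec after_first_loop s tr s',
        st_k s' = st_k s,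
        st_y s' = (x + y)%N.-1,
        forall j, j < st_k s -> st_a s' j = st_a s j &
        count is_write_after_init tr = 2 * size (ascending f x y) - 1].
Proof.
move=> x0 y2x yf sx sy.
pose s1 := State (st_k s) (st_k s + 1) (st_x s) (st_y s) (st_a s).
have [|||tr [s2 [E ks2 ys2 as2 cs2]]] :=
  @exec_second_loop f x y s1 x0 y2x yf; rewrite //.
do 2 eexists; split.
- apply: exec_Seq; first exact: exec_SetL.
  apply: exec_Seq; first exact: E.
  by do !(apply: exec_Seq; first by exec_assignment); exec_assignment.
- by rewrite /= ks2.
- by rewrite /= ys2; lia.
- move=> j jk; rewrite /= /upd ks2 as2 //=.
  by case: eqP => //; lia.
- rewrite /= !count_cat /= cs2.
  by have := @size_ascending_gt0 f x y x0 yf; lia.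
Qed.

(** Stated for an arbitrary continuation [tr2] of the main loop: what is described
    is the part of the run until the main loop is back at position [k]. *)
Lemma exec_main_loop_body f (x y : nat) s :
    0 < x -> y < f -> 0 < st_k s -> st_x s = x -> st_y s = y ->
  exists tr s',
    [/\ forall tr2 s2, exec main_loop s' tr2 s2 ->
          exec (first_loop ;; after_first_loop ;; main_loop)%cmd s (tr ++ tr2) s2,
        st_k s' = st_k s,
        st_y s' = (x + y)%N.-1,
        forall j, j < st_k s -> st_a s' j = st_a s j &
        count is_write_after_init tr = 2 * size (ascending f x y) - 1].
Proof.
elim: f x y s => // f IH x y s x0 yf k0 sx sy.
have [le2xy|lty2x] := leqP (2 * x) y; last first.
  have [tr [s' [E ks' ys' as' cs']]] := exec_after_first_loop x0 lty2x yf sx sy.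
  exists tr, s'; split=> // tr2 s2 E2; rewrite -[_ ++ _]/([::] ++ (tr ++ tr2)).
  apply: exec_Seq (exec_Seq E E2).
  by apply: exec_While_false; rewrite sx sy; lia.
(* The state after one pass of the first inner loop, where the compositions starting with [x] are
   treated. *)
pose s1 := State (st_k s + 1) (st_l s) (st_x s) (st_y s - st_x s)%R
  (upd (st_a s) (st_k s) (st_x s)).
have [|||||tr1 [s2 [E1 ks2 ys2 as2 cs2]]] := IH x (y - x) s1;
  rewrite /= ?sx ?sy; try lia.
(* The sub-run at position [k + 1] leaves [a_k] intact, so the main loop next loads [x + 1], giving
   [s3]. *)
have ask : st_a s2 (st_k s) = x.
  by rewrite as2 /= ?addn1 // /upd eqxx sx.
pose s3 := State (st_k s) (st_l s2) (st_a s2 (st_k s) + 1)%R (st_y s2) (st_a s2).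
have [|||||tr3 [s4 [E3 ks4 ys4 as4 cs4]]] := IH x.+1 y.-1 s3;
  rewrite /= ?ask ?ys2; try lia.
exists ([:: Wrote Write_k_first] ++ tr1 ++ tr3), s4; split=> //.
- move=> tr5 s5 E5; have {E3 E5} E3 := E3 _ _ E5.
  (* Prefixed by the decrement of [k] and the load of [x], the second sub-run starts a pass of
     [main_loop] from [s2], as the continuation of the first requires. *)
  have {E1 E3} E1 : exec (first_loop ;; after_first_loop ;; main_loop)%cmd s1
      (tr1 ++ tr3 ++ tr5) s5.
    apply: E1; move: E3; set tr := tr3 ++ tr5 => E.
    inversion E as [| | | | | |? ? ? sa ? tra trb' Ea Eb| |]; subst.
    inversion Eb as [| | | | | |? ? ? sb ? trb trc Eb1 Ec| |]; subst.
    rewrite catA; apply: exec_While_true Ec; first by rewrite ks2 /=; lia.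
    rewrite -[tra ++ trb]/([::] ++ [::] ++ tra ++ trb).
    apply: exec_Seq; first exact: exec_SetK.
    apply: exec_Seq; first exact: exec_SetX.
    by rewrite /= ks2 /= addnK; apply: exec_Seq Eb1.
  rewrite -!catA.
  inversion E1 as [| | | | | |? ? ? sa ? tra trb Ea Eb| |]; subst.
  rewrite catA; apply: exec_Seq Eb; apply: exec_While_true Ea.
    by rewrite sx sy; lia.
  rewrite -[[:: _]]/([:: Wrote Write_k_first] ++ [::] ++ [::]).
  by do !(apply: exec_Seq; first by exec_assignment); exec_assignment.
- by rewrite ys4; lia.
- move=> j jk; rewrite as4 //= as2 /=; last by lia.
  by rewrite /upd; case: eqP => //; lia.
(* With [A] and [B] the two sizes, [1 + (2 * A - 1) + (2 * B - 1) = 2 * (A + B) - 1]. *)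
- have := @size_ascending_gt0 f x (y - x); have := @size_ascending_gt0 f x.+1 y.-1.
  have -> : x <= y by lia.
  by rewrite !count_cat /= cs2 cs4 size_cat size_map; lia.
Qed.

Theorem theorem4p12 (n : nat) (hn : 0 < n) (s : state) :
  (exists tr s', exec (AccelAsc n) s tr s') /\
  (forall tr s', exec (AccelAsc n) s tr s' ->
     count is_write_after_init tr = 2 * num_partitions n - 1).
Proof.
suff [tr [s' [E c]]] : exists tr s', exec (AccelAsc n) s tr s' /\
    count is_write_after_init tr = 2 * num_partitions n - 1.
  split; first by exists tr, s'.
  by move=> tr2 s2 /(exec_deterministic E)[<- _].
(* The state in the first pass just before the first inner loop: [x = a_1 + 1 = 1]. *)
pose s1 := State 1 (st_l s) 1%R (n%:Z - 1)%R (upd (st_a s) 1 0%R).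
have [|||||tr [s2 [E ks2 _ _ c2]]] := @exec_main_loop_body n 1 n.-1 s1;
  rewrite //=; try lia.
(* Back at [k = 1] the guard fails, so the continuation is empty. *)
have main_done : exec main_loop s2 [::] s2.
  by apply: exec_While_false; rewrite ks2.
have {E main_done} := E _ _ main_done; rewrite cats0 => E.
inversion E as [| | | | | |? ? ? sa ? tra trb' Ea Eb| |]; subst.
inversion Eb as [| | | | | |? ? ? sb ? trb trc Eb1 Ec| |]; subst.
exists ([::] ++ [:: Wrote Write_init] ++ [::] ++
  ([::] ++ [::] ++ tra ++ trb) ++ trc), s2; split.
  rewrite AccelAscE.
  do 3 (apply: exec_Seq; first by exec_assignment).
  apply: exec_While_true Ec => //.
  by do 2 (apply: exec_Seq; first by exec_assignment); apply: exec_Seq Eb1.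
by rewrite /= num_partitionsE // -c2 !count_cat !addnA.
Qed.
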